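(* Let $(R,\iota_R,\nabla_{R,d})$ and $(S,\iota_S,\nabla_{S,d})$ be quasicoherent sheaves of rings on $\mathsf{Def}$ which satisfy the Frobenius congruence, and suppose that $(S,\mathfrak{m}S,\psi_S)$ is complete and perfect as an object of $\mathcal{C}_{p^h}$. Then for any $\mathcal{O}$-algebra homomorphism $\mu\colon R\to S$ there exists a unique morphism of quasicoherent sheaves of rings $\widehat\mu\colon R\to S$ such that $\widehat\mu(x)\equiv\mu(x)\bmod\mathfrak{m}S$ for all $x\in R$.
   Context: Fix a prime $p$, a perfect field $\kappa$ of characteristic $p$, and a formal group $\Gamma/\kappa$ of height $1\le h<\infty$. Let $\mathcal{O}$ be the Lubin–Tate ring (maximal ideal $\mathfrak{m}$, residue field $\kappa$) and, for $d\ge0$, $\mathcal{O}_d$ the Strickland ring classifying subgroups of rank $p^d$ of the universal deformation (complete local, maximal ideal $\mathfrak{m}_d$, residue field $\kappa$, $\mathcal{O}_0=\mathcal{O}$), with source/target maps $s_d,t_d\colon\mathcal{O}\to\mathcal{O}_d$ ($s_d$ making $\mathcal{O}_d$ finitely generated free over $\mathcal{O}$) and composition maps $\nabla_{d,e}\colon\mathcal{O}_{d+e}\to\mathcal{O}_d\otimes_{s_d,\mathcal{O},t_e}\mathcal{O}_e$, forming the graded category scheme representing deformations of $\Gamma$ and their height-$d$ morphisms. There are surjections $\nu_d\colon\mathcal{O}_d\to\mathcal{O}/p$ (representing height-$d$ Frobenius morphisms) with $\nu_ds_d$ the quotient map, $\nu_dt_d$ the $p^d$-th power map, and $\mathcal{O}_d\to\mathcal{O}/p\to\kappa$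 the quotient map; ring automorphisms $\psi_{\mathcal{O}_d}$ of $\mathcal{O}_d$ compatible with $s_d,t_d$, representing the autoequivalence of deformations induced by $\sigma\colon(\phi^h)^*\Gamma\cong\Gamma$ where $[p]=\sigma\operatorname{Fr}^h$; and $q\colon\mathcal{O}_h\to\mathcal{O}$ representing the $p$-th power isogeny, with $qs_h=\mathrm{id}$, $qt_h=\psi_{\mathcal{O}}$, $(q\otimes\mathrm{id})\nabla_{h,d}=(\psi_{\mathcal{O}_d}\otimes q)\nabla_{d,h}$, and $\psi_{\mathcal{O}_d}(x)\equiv x^{p^h}\bmod\mathfrak{m}_d$. A quasicoherent sheaf of rings on $\mathsf{Def}$ is a triple $(R,\iota_R,\nabla_{R,d})$: a commutative ring $R$, a ring map $\iota_R\colon\mathcal{O}\to R$, and ring maps $\nabla_{R,d}\colon R\to\mathcal{O}_d\otimes_{s_d,\mathcal{O},\iota_R}R$ ($d\ge0$) with $(\mathrm{id}\otimes\nabla_{R,e})\nabla_{R,d}=(\nabla_{d,e}\otimes\mathrm{id})\nabla_{R,d+e}$ and $\nabla_{R,d}\iota_R=(\mathrm{id}\otimes\iota_R)t_d$; morphisms are ring maps compatible with all structure. It satisfies the Frobenius congruence if $(\nu_d\otimes\mathrm{id})\nabla_{R,d}\colon R\to R/p$ equals $x\mapsto x^{p^d}\bmod p$ for all $d$. Its Adams operation is $\psi_R=(q\otimes\mathrm{id})\nabla_{R,h}\colon R\to R$. $\mathcal{C}_{p^h}$ is the category of triples $(R,I_R,\psi_R)$ with $I_R\ni p$ an ideal of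 the commutative ring $R$ and $\psi_R$ a ring endomorphism with $\psi_R(x)\equiv x^{p^h}\bmod I_R$; such an object is complete if $R\cong\lim_kR/I_R^k$ and perfect if $\psi_R$ is an isomorphism with $\psi_R(I_R)=I_R$. *)

(* Defs.v *)
From mathcomp Require Import all_boot all_algebra.
Set Implicit Arguments.
Unset Strict Implicit.
Unset Printing Implicit Defensive.
Import GRing.Theory.
Local Open Scope ring_scope.

Notation cring := comPzRingType.

(* Tensor products of commutative rings  B (x)_{f,A,g} C, given by the *)
(* universal property of the pushout in commutative rings.             *)
Record pushout (A B C : cring) (f : {rmorphism A -> B}) (g : {rmorphism A -> C}) :=
  Pushout {
  po_car : cring;
  po_l : {rmorphism B -> po_car};
  po_r : {rmorphism C -> po_car};
  po_comm : forall a, po_l (f a) = po_r (g a);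
  po_univ : forall (D : cring) (u : {rmorphism B -> D}) (v : {rmorphism C -> D}),
      (forall a, u (f a) = v (g a)) ->
      {w : {rmorphism po_car -> D} | (forall b, w (po_l b) = u b) /\
                                     (forall c, w (po_r c) = v c)};
  po_uniq : forall (D : cring) (w w' : {rmorphism po_car -> D}),
      (forall b, w (po_l b) = w' (po_l b)) ->
      (forall c, w (po_r c) = w' (po_r c)) -> forall x, w x = w' x }.

Definition tensor_choice :=
  forall (A B C : cring) (f : {rmorphism A -> B}) (g : {rmorphism A -> C}), pushout f g.

Section Tensor.
Variable TP : tensor_choice.

Definition Tens (A B C : cring) (f : {rmorphism A -> B}) (g : {rmorphism A -> C}) : cring :=
  po_car (TP f g).
Definition tinl (A B C : cring) (f : {rmorphism A -> B}) (g : {rmorphism A -> C}) :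
  {rmorphism B -> Tens f g} := po_l (TP f g).
Definition tinr (A B C : cring) (f : {rmorphism A -> B}) (g : {rmorphism A -> C}) :
  {rmorphism C -> Tens f g} := po_r (TP f g).

Definition tlift (A B C D : cring) (f : {rmorphism A -> B}) (g : {rmorphism A -> C})
  (u : {rmorphism B -> D}) (v : {rmorphism C -> D}) (H : forall a, u (f a) = v (g a)) :
  {rmorphism Tens f g -> D} := proj1_sig (po_univ (TP f g) H).

Lemma tlift_l A B C D f g u v H b :
  @tlift A B C D f g u v H (tinl f g b) = u b.
Proof. exact: (proj1 (proj2_sig (po_univ (TP f g) H))). Qed.
Lemma tlift_r A B C D f g u v H c :
  @tlift A B C D f g u v H (tinr f g c) = v c.
Proof. exact: (proj2 (proj2_sig (po_univ (TP f g) H))). Qed.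
Lemma tcomm A B C f g a : tinl f g (f a) = tinr f g (g a) :> @Tens A B C f g.
Proof. exact: po_comm. Qed.
End Tensor.

Definition is_ideal (A : cring) (I : A -> Prop) :=
  I 0 /\ (forall x y, I x -> I y -> I (x + y)) /\ (forall a x, I x -> I (a * x)).

Definition ideal_pow (A : cring) (I : A -> Prop) (k : nat) (x : A) :=
  exists (n : nat) (c : 'I_n -> A) (a : 'I_n -> 'I_k -> A),
    (forall i j, I (a i j)) /\ x = \sum_(i < n) c i * \prod_(j < k) a i j.

Definition ext_ideal (A B : cring) (f : {rmorphism A -> B}) (I : A -> Prop) (x : B) :=
  exists (n : nat) (a : 'I_n -> A) (y : 'I_n -> B),
    (forall i, I (a i)) /\ x = \sum_(i < n) f (a i) * y i.

(* A -> lim_k A/I^k is bijective *)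
Definition adic_complete (A : cring) (I : A -> Prop) :=
  (forall x, (forall k, ideal_pow I k x) -> x = 0) /\
  (forall u : nat -> A, (forall k, ideal_pow I k (u k.+1 - u k)) ->
     exists x, forall k, ideal_pow I k (x - u k)).

Definition is_unit_elt (A : cring) (x : A) := exists y, x * y = 1.

Definition complete_local (A : cring) (m : A -> Prop) (kappa : fieldType)
  (res : {rmorphism A -> kappa}) :=
  is_ideal m /\ ~ m 1 /\ (forall x, ~ m x -> is_unit_elt x) /\
  (forall x, m x <-> res x = 0) /\ (forall y, exists x, res x = y) /\
  adic_complete m.

Definition finite_free (A B : cring) (f : {rmorphism A -> B}) :=
  exists (n : nat) (b : 'I_n -> B),
    forall y, exists c : 'I_n -> A, y = \sum_(i < n) f (c i) * b i /\
      forall c' : 'I_n -> A, y = \sum_(i < n) f (c' i) * b i -> c' =1 c.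

Record LTdata (TP : tensor_choice) := LTData {
  lt_p : nat;
  lt_p_prime : prime lt_p;
  lt_h : nat;
  lt_h_pos : (1 <= lt_h)%N;
  kappa : fieldType;
  kappa_char : lt_p \in [pchar kappa];
  kappa_perfect : forall y : kappa, exists x, x ^+ lt_p = y;
  O : cring;
  mO : O -> Prop;
  resO : {rmorphism O -> kappa};
  O_cl : complete_local mO resO;
  Od : nat -> cring;
  mOd : forall d, Od d -> Prop;
  resOd : forall d, {rmorphism Od d -> kappa};
  Od_cl : forall d, complete_local (@mOd d) (resOd d);
  src : forall d, {rmorphism O -> Od d};
  tgt : forall d, {rmorphism O -> Od d};
  src_free : forall d, finite_free (src d);
  (* O_0 = O *)
  src0_bij : bijective (src 0);
  tgt0_src0 : forall a, tgt 0 a = src 0 a;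
  nab : forall d e, {rmorphism Od (d + e) -> Tens TP (src d) (tgt e)};
  nab_src : forall d e a, nab d e (src (d + e) a) = tinr TP (src d) (tgt e) (src e a);
  nab_tgt : forall d e a, nab d e (tgt (d + e) a) = tinl TP (src d) (tgt e) (tgt d a);
  Op : cring;
  quotp : {rmorphism O -> Op};
  quotp_surj : forall y, exists x, quotp x = y;
  quotp_ker : forall x, quotp x = 0 <-> exists y, x = lt_p%:R * y;
  nu : forall d, {rmorphism Od d -> Op};
  nu_surj : forall d y, exists x, nu d x = y;
  nu_src : forall d a, nu d (src d a) = quotp a;
  nu_tgt : forall d a, nu d (tgt d a) = quotp (a ^+ (lt_p ^ d));
  nu_res : forall d x y, nu d x = quotp y -> resOd d x = resO y;
  psiO : {rmorphism O -> O};
  psiO_bij : bijective psiO;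
  psiOd : forall d, {rmorphism Od d -> Od d};
  psiOd_bij : forall d, bijective (psiOd d);
  psiOd_src : forall d a, psiOd d (src d a) = src d (psiO a);
  psiOd_tgt : forall d a, psiOd d (tgt d a) = tgt d (psiO a);
  psiOd_frob : forall d x, mOd (psiOd d x - x ^+ (lt_p ^ lt_h));
  psiO_frob : forall x, mO (psiO x - x ^+ (lt_p ^ lt_h));
  (* the p-th power isogeny q : O_h -> O *)
  q : {rmorphism Od lt_h -> O};
  q_src : forall a, q (src lt_h a) = a;
  q_tgt : forall a, q (tgt lt_h a) = psiO a;
  (* (q (x) id) nabla_{h,d} = (psi_{O_d} (x) q) nabla_{d,h} *)
  q_nab : forall d (x : Od (lt_h + d)),
    @tlift TP O (Od lt_h) (Od d) (Od d) (src lt_h) (tgt d) (tgt d \o q) idfun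
          (fun a => f_equal (tgt d) (q_src a)) (nab lt_h d x)
    = @tlift TP O (Od d) (Od lt_h) (Od d) (src d) (tgt lt_h) (psiOd d) (src d \o q)
          (fun a => etrans (psiOd_src d a) (f_equal (src d) (esym (q_tgt a))))
          (nab d lt_h (eq_rect _ (fun n => Od n : Type) x _ (addnC lt_h d)))
}.

Section Sheaves.
Variables (TP : tensor_choice) (L : LTdata TP).

Local Notation O := (O L).
Local Notation Od := (Od L).
Local Notation src := (src L).
Local Notation tgt := (tgt L).

Section Maps.
Variables (Rc : cring) (iota : {rmorphism O -> Rc})
  (nabR : forall d, {rmorphism Rc -> Tens TP (src d) iota})
  (Hni : forall d a, nabR d (iota a) = tinl TP (src d) iota (tgt d a)).

Definition jt (e : nat) : {rmorphism O -> Tens TP (src e) iota} :=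
  tinl TP (src e) iota \o tgt e.

Definition id_nab (d e : nat) :
  {rmorphism Tens TP (src d) iota -> Tens TP (src d) (jt e)}.
Proof.
refine (@tlift TP O (Od d) Rc _ (src d) iota (tinl TP (src d) (jt e))
          (tinr TP (src d) (jt e) \o nabR e) _).
by move=> a /=; rewrite Hni; exact: tcomm.
Defined.

Definition ks (d e : nat) : {rmorphism O -> Tens TP (src d) (tgt e)} :=
  tinr TP (src d) (tgt e) \o src e.

Definition nab_id (d e : nat) :
  {rmorphism Tens TP (src (d + e)) iota -> Tens TP (ks d e) iota}.
Proof.
refine (@tlift TP O (Od (d + e)) Rc _ (src (d + e)) iota
          (tinl TP (ks d e) iota \o nab L d e) (tinr TP (ks d e) iota) _).
by move=> a /=; rewrite nab_src; exact: tcomm.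
Defined.

Definition assoc_X (d e : nat) :
  {rmorphism Tens TP (src d) (tgt e) -> Tens TP (src d) (jt e)}.
Proof.
refine (@tlift TP O (Od d) (Od e) _ (src d) (tgt e) (tinl TP (src d) (jt e))
          (tinr TP (src d) (jt e) \o tinl TP (src e) iota) _).
by move=> a /=; exact: tcomm.
Defined.

Definition tassoc (d e : nat) :
  {rmorphism Tens TP (ks d e) iota -> Tens TP (src d) (jt e)}.
Proof.
refine (@tlift TP O _ Rc _ (ks d e) iota (assoc_X d e)
          (tinr TP (src d) (jt e) \o tinr TP (src e) iota) _).
by move=> a /=; rewrite /assoc_X tlift_r /= tcomm.
Defined.
End Maps.

Record qc_sheaf := QCSheaf {
  sh_car : cring;
  sh_iota : {rmorphism O -> sh_car};
  sh_nab : forall d, {rmorphism sh_car -> Tens TP (src d) sh_iota};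
  sh_nab_iota : forall d a,
    sh_nab d (sh_iota a) = tinl TP (src d) sh_iota (tgt d a);
  sh_coassoc : forall d e x,
    id_nab sh_nab_iota d e (sh_nab d x)
    = tassoc sh_iota d e (nab_id sh_iota d e (sh_nab (d + e) x))
}.

Definition nu_id (R : qc_sheaf) (d : nat) :
  {rmorphism Tens TP (src d) (sh_iota R) -> Tens TP (quotp L) (sh_iota R)}.
Proof.
refine (@tlift TP O (Od d) (sh_car R) _ (src d) (sh_iota R)
          (tinl TP (quotp L) (sh_iota R) \o nu L d) (tinr TP (quotp L) (sh_iota R)) _).
by move=> a /=; rewrite nu_src; exact: tcomm.
Defined.

(* Frobenius congruence: (nu_d (x) id) nabla_{R,d} (x) = x^{p^d} mod p,
   where O/p (x)_O R is identified with R/p via the canonical map from R. *)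
Definition frobenius_congruence (R : qc_sheaf) :=
  forall d (x : sh_car R),
    nu_id R d (sh_nab R d x) = tinr TP (quotp L) (sh_iota R) (x ^+ (lt_p L ^ d)).

Definition psi_sh (R : qc_sheaf) : {rmorphism sh_car R -> sh_car R}.
Proof.
refine (@tlift TP O (Od (lt_h L)) (sh_car R) (sh_car R) (src (lt_h L)) (sh_iota R)
          (sh_iota R \o q L) idfun _ \o sh_nab R (lt_h L)).
by move=> a /=; rewrite q_src.
Defined.

Definition id_tens (R S : qc_sheaf) (f : {rmorphism sh_car R -> sh_car S})
  (Hf : forall a, f (sh_iota R a) = sh_iota S a) (d : nat) :
  {rmorphism Tens TP (src d) (sh_iota R) -> Tens TP (src d) (sh_iota S)}.
Proof.
refine (@tlift TP O (Od d) (sh_car R) _ (src d) (sh_iota R)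
          (tinl TP (src d) (sh_iota S)) (tinr TP (src d) (sh_iota S) \o f) _).
by move=> a /=; rewrite Hf; exact: tcomm.
Defined.

Definition sheaf_morphism (R S : qc_sheaf) (f : {rmorphism sh_car R -> sh_car S}) :=
  exists Hf : (forall a, f (sh_iota R a) = sh_iota S a),
    forall d x, sh_nab S d (f x) = id_tens Hf d (sh_nab R d x).

Definition mS (S : qc_sheaf) : sh_car S -> Prop := ext_ideal (sh_iota S) (@mO _ L).

End Sheaves.

Definition Cph_object (p h : nat) (A : cring) (I : A -> Prop) (psi : {rmorphism A -> A}) :=
  is_ideal I /\ I (p%:R) /\ forall x, I (psi x - x ^+ (p ^ h)).

Definition Cph_complete (A : cring) (I : A -> Prop) := adic_complete I.

Definition Cph_perfect (A : cring) (I : A -> Prop) (psi : {rmorphism A -> A}) :=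
  bijective psi /\ (forall x, I x -> I (psi x)) /\
  (forall y, I y -> exists x, I x /\ psi x = y).

Arguments mS {TP L} S _.

(* Main.v *)
(* For maps [f, g : R -> S] that agree on [O] and modulo
   [m ^ k S], the maps [psi^-1 f psi] and [psi^-1 g psi] agree modulo
   [m ^ (k + 1) S], because [psi x] is [x ^+ (p ^ h)] up to an element of [mR] and both
   Frobenius powers and multiplication by [m] gain one order. Hence
   [psi^-n mu psi^n] converges to the unique [psi]-equivariant map congruent to
   [mu]. To see that this limit commutes with [nabla_d], apply the same
   uniqueness to the two resulting maps from [R] to [O_d (x) S]: they agree on
   [O], are [psi]-equivariant by coassociativity and [q_nab], and agree modulo
   [m_d] since there both are the [p ^ d]-th power map. It remains that the
   target is separated: it is a free [S]-module, and a power of [m_d] lies in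
   [m O_d]. *)
From HB Require Import structures.
Require Import Defs.
From mathcomp Require Import all_boot all_algebra boolp.
Set Implicit Arguments.
Unset Strict Implicit.
Unset Printing Implicit Defensive.
Import GRing.Theory.
Local Open Scope ring_scope.

(** * Ideals given as predicates *)

Lemma ideal0 (A : cring) (I : A -> Prop) : is_ideal I -> I 0.
Proof. by case. Qed.

Lemma idealD (A : cring) (I : A -> Prop) x y : is_ideal I -> I x -> I y -> I (x + y).
Proof. by case=> _ [HD _]; apply: HD. Qed.

Lemma idealMl (A : cring) (I : A -> Prop) a x : is_ideal I -> I x -> I (a * x).
Proof. by case=> _ [_ HM]; apply: HM. Qed.

Lemma idealMr (A : cring) (I : A -> Prop) a x : is_ideal I -> I x -> I (x * a).
Proof. by rewrite mulrC; apply: idealMl. Qed.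

Lemma idealN (A : cring) (I : A -> Prop) x : is_ideal I -> I x -> I (- x).
Proof. by move=> HI Hx; rewrite -mulN1r; apply: idealMl. Qed.

Lemma idealB (A : cring) (I : A -> Prop) x y : is_ideal I -> I x -> I y -> I (x - y).
Proof. by move=> HI Hx Hy; apply: idealD => //; apply: idealN. Qed.

Lemma idealBC (A : cring) (I : A -> Prop) x y : is_ideal I -> I (x - y) -> I (y - x).
Proof. by move=> HI Hxy; rewrite -opprB; apply: idealN. Qed.

Lemma ideal_sum (A : cring) (I : A -> Prop) (n : nat) (F : 'I_n -> A) :
  is_ideal I -> (forall i, I (F i)) -> I (\sum_(i < n) F i).
Proof.
move=> HI HF; apply: (big_ind I) => [|x y|i _]; first exact: ideal0.
- exact: idealD.
- exact: HF.
Qed.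

Lemma ideal_trans (A : cring) (I : A -> Prop) y x z :
  is_ideal I -> I (x - y) -> I (y - z) -> I (x - z).
Proof. by move=> HI H1 H2; rewrite -(subrKA y); apply: idealD. Qed.

Lemma ideal_preimage (A B : cring) (f : {rmorphism A -> B}) (J : B -> Prop) :
  is_ideal J -> is_ideal (fun x => J (f x)).
Proof.
move=> HJ; split; first by rewrite rmorph0; apply: ideal0.
split=> [x y Hx Hy|a x Hx]; first by rewrite rmorphD; apply: idealD.
by rewrite rmorphM; apply: idealMl.
Qed.

(** * Quotient rings *)

Section QuotientRing.
Variables (A : cring) (J : A -> Prop) (HJ : is_ideal J).

(** Boolean reflection of an arbitrary proposition supplies the boolean equivalence relation that
    generic quotients expect. *)
Definition ideal_rel (x y : A) : bool := `[< J (x - y) >].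

Lemma ideal_rel_equiv : equiv_class_of ideal_rel.
Proof.
split=> [x|x y|y x z]; rewrite /ideal_rel.
- by apply/asboolP; rewrite subrr; apply: ideal0.
- by apply/asboolP/asboolP; apply: idealBC.
- by move=> /asboolP Hxy /asboolP Hyz; apply/asboolP; apply: ideal_trans Hxy Hyz.
Qed.

Canonical ideal_equiv_rel := EquivRelPack ideal_rel_equiv.

Local Open Scope quotient_scope.
Definition quotient_ring := {eq_quot ideal_equiv_rel}.
HB.instance Definition _ := Quotient.on quotient_ring.
HB.instance Definition _ := Choice.on quotient_ring.

Definition quotient_proj (x : A) : quotient_ring := \pi_quotient_ring x.

Lemma quotient_ind (P : quotient_ring -> Prop) :
  (forall x, P (quotient_proj x)) -> forall a, P a.
Proof. by move=> HP a; rewrite -[a]reprK; apply: HP. Qed.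

Lemma quotient_eqP (x y : A) : quotient_proj x = quotient_proj y <-> J (x - y).
Proof.
split=> [/eqP|Hxy]; first by rewrite eqmodE => /asboolP.
by apply/eqP; rewrite eqmodE; apply/asboolP.
Qed.

Lemma quotient_reprB (x : A) : J (repr (quotient_proj x) - x).
Proof. by apply/quotient_eqP; rewrite /quotient_proj reprK. Qed.

Definition quotient_add (a b : quotient_ring) := quotient_proj (repr a + repr b).
Definition quotient_opp (a : quotient_ring) := quotient_proj (- repr a).
Definition quotient_mul (a b : quotient_ring) := quotient_proj (repr a * repr b).

Lemma quotient_addE x y :
  quotient_add (quotient_proj x) (quotient_proj y) = quotient_proj (x + y).
Proof.
apply/quotient_eqP; rewrite opprD addrACA.
by apply: idealD => //; apply: quotient_reprB.
Qed.

Lemma quotient_oppE x : quotient_opp (quotient_proj x) = quotient_proj (- x).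
Proof.
by apply/quotient_eqP; rewrite -opprD; apply: idealN => //; apply: quotient_reprB.
Qed.

Lemma quotient_mulE x y :
  quotient_mul (quotient_proj x) (quotient_proj y) = quotient_proj (x * y).
Proof.
apply/quotient_eqP; set x' := repr _; set y' := repr _.
have -> : x' * y' - x * y = (x' - x) * y' + x * (y' - y) by rewrite mulrBl mulrBr subrKA.
by apply: (idealD HJ); [apply: (idealMr _ HJ) | apply: (idealMl _ HJ)]; apply: quotient_reprB.
Qed.

Let quotientE := (quotient_addE, quotient_oppE, quotient_mulE).

Fact quotient_addA : associative quotient_add.
Proof. by elim/quotient_ind=> x; elim/quotient_ind=> y; elim/quotient_ind=> z; rewrite !quotientE addrA. Qed.
Fact quotient_addC : commutative quotient_add.
Proof. by elim/quotient_ind=> x; elim/quotient_ind=> y; rewrite !quotientE addrC. Qed.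
Fact quotient_add0 : left_id (quotient_proj 0) quotient_add.
Proof. by elim/quotient_ind=> x; rewrite !quotientE add0r. Qed.
Fact quotient_addN : left_inverse (quotient_proj 0) quotient_opp quotient_add.
Proof. by elim/quotient_ind=> x; rewrite !quotientE addNr. Qed.

HB.instance Definition _ := GRing.isZmodule.Build quotient_ring
  quotient_addA quotient_addC quotient_add0 quotient_addN.

Fact quotient_mulA : associative quotient_mul.
Proof. by elim/quotient_ind=> x; elim/quotient_ind=> y; elim/quotient_ind=> z; rewrite !quotientE mulrA. Qed.
Fact quotient_mulC : commutative quotient_mul.
Proof. by elim/quotient_ind=> x; elim/quotient_ind=> y; rewrite !quotientE mulrC. Qed.
Fact quotient_mul1 : left_id (quotient_proj 1) quotient_mul.
Proof. by elim/quotient_ind=> x; rewrite !quotientE mul1r. Qed.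
Fact quotient_mulDl : left_distributive quotient_mul +%R.
Proof.
by elim/quotient_ind=> x; elim/quotient_ind=> y; elim/quotient_ind=> z; rewrite /GRing.add /= !quotientE mulrDl.
Qed.

HB.instance Definition _ := GRing.Zmodule_isComPzRing.Build quotient_ring
  quotient_mulA quotient_mulC quotient_mul1 quotient_mulDl.

Fact quotient_proj_zmod : zmod_morphism quotient_proj.
Proof. by move=> x y; rewrite /GRing.opp /GRing.add /= !quotientE. Qed.
Fact quotient_proj_monoid : monoid_morphism quotient_proj.
Proof. by split=> // x y; rewrite /GRing.mul /= !quotientE. Qed.

HB.instance Definition _ := GRing.isZmodMorphism.Build _ _ quotient_proj quotient_proj_zmod.
HB.instance Definition _ := GRing.isMonoidMorphism.Build _ _ quotient_proj quotient_proj_monoid.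

Lemma quotient_proj_eq0 x : quotient_proj x = 0 <-> J x.
Proof. by rewrite -(rmorph0 quotient_proj) quotient_eqP subr0. Qed.
End QuotientRing.

(** Turns a congruence modulo [J] into an equation after [pi], so that uniqueness of maps out of a
    tensor product can prove congruences. *)
Lemma ideal_quotient (A : cring) (J : A -> Prop) : is_ideal J ->
  exists (Q : cring) (pi : {rmorphism A -> Q}), forall x, pi x = 0 <-> J x.
Proof. by move=> HJ; exists _, (quotient_proj HJ) => x; apply: quotient_proj_eq0. Qed.

(** * Inverses and factorizations of ring maps *)

Lemma inverse_rmorphism (A B : cring) (f : {rmorphism A -> B}) : bijective f ->
  exists g : {rmorphism B -> A}, cancel f g /\ cancel g f.
Proof.
case=> g fK gK.
pose ga := GRing.isZmodMorphism.Build _ _ g (can2_zmod_morphism fK gK).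
pose gm := GRing.isMonoidMorphism.Build _ _ g (can2_monoid_morphism fK gK).
pose G : {rmorphism B -> A} := HB.pack g ga gm.
by exists G.
Qed.

Lemma rmorphism_factor (A B D : cring) (f : {rmorphism A -> B}) (u : {rmorphism A -> D}) :
  (forall y, exists x, f x = y) -> (forall x, f x = 0 -> u x = 0) ->
  exists w : {rmorphism B -> D}, forall x, w (f x) = u x.
Proof.
move=> /choice[s sK] Hker.
have Hu x : u (s (f x)) = u x.
  by apply/eqP; rewrite -subr_eq0 -rmorphB Hker // rmorphB sK subrr.
pose g y := u (s y).
have ga : zmod_morphism g.
  by move=> x y; rewrite /g -rmorphB -[RHS]Hu rmorphB !sK.
have gm : monoid_morphism g.
  by split=> [|x y]; rewrite /g -?rmorphM -1?[RHS]Hu ?rmorphM ?sK // -(rmorph1 f) Hu rmorph1.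
pose gaM := GRing.isZmodMorphism.Build _ _ g ga.
pose gmM := GRing.isMonoidMorphism.Build _ _ g gm.
pose G : {rmorphism B -> D} := HB.pack g gaM gmM.
by exists G.
Qed.
(** * Powers and extensions of ideals *)

Lemma ideal_pow_is_ideal (A : cring) (I : A -> Prop) k : is_ideal (ideal_pow I k).
Proof.
split; [|split].
- by exists 0, (fun=> 0), (fun=> fun=> 0); split=> [[]//|]; rewrite big_ord0.
- move=> x y [n [c [a [Ha ->]]]] [m [d [b [Hb ->]]]].
  exists (n + m)%N, (fun i => match split i with inl j => c j | inr j => d j end),
    (fun i => match split i with inl j => a j | inr j => b j end).
  split=> [i j|]; first by case: (split i).
  by rewrite big_split_ord; congr (_ + _); apply: eq_bigr => i _;
    rewrite ?(unsplitK (inl i)) ?(unsplitK (inr i)).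
- move=> r x [n [c [a [Ha ->]]]]; exists n, (fun i => r * c i), a; split=> //.
  by rewrite mulr_sumr; apply: eq_bigr => i _; rewrite mulrA.
Qed.

Lemma ideal_pow_prod (A : cring) (I : A -> Prop) k (a : 'I_k -> A) :
  (forall j, I (a j)) -> ideal_pow I k (\prod_(j < k) a j).
Proof. by move=> Ha; exists 1, (fun=> 1), (fun=> a); rewrite big_ord1 mul1r. Qed.

Lemma ideal_pow0 (A : cring) (I : A -> Prop) x : ideal_pow I 0 x.
Proof.
rewrite -[x]mulr1; apply: idealMl; first exact: ideal_pow_is_ideal.
by exists 1, (fun=> 1), (fun=> fun=> 0); split=> [? []//|]; rewrite big_ord1 big_ord0 mulr1.
Qed.

(** An elimination principle for powers of [I]: a sum of multiples reduces to a single product,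
    whose factors are peeled off one at a time. *)
Lemma ideal_pow_le_filtration (A : cring) (I : A -> Prop) (F : nat -> A -> Prop) k x :
  (forall l, is_ideal (F l)) -> F 0 1 ->
  (forall l u v, I u -> F l v -> F l.+1 (u * v)) -> ideal_pow I k x -> F k x.
Proof.
move=> HF F1 FM [n [c [a [Ha ->]]]]; apply: ideal_sum => // i; apply: idealMl => //.
move: {a Ha}(a i) (Ha i); elim: k => [|k IHk] a Ha; first by rewrite big_ord0.
by rewrite big_ord_recl; apply: FM => //; apply: IHk.
Qed.

Lemma ideal_pow_addP (A : cring) (I K : A -> Prop) m n x : is_ideal K ->
  (forall u v, ideal_pow I m u -> ideal_pow I n v -> K (u * v)) ->
  ideal_pow I (m + n) x -> K x.
Proof.
move=> HK HM [l [c [a [Ha ->]]]]; apply: ideal_sum => // i; apply: idealMl => //.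
by rewrite big_split_ord; apply: HM; apply: ideal_pow_prod.
Qed.

Lemma ideal_powM (A : cring) (I : A -> Prop) k x y :
  I x -> ideal_pow I k y -> ideal_pow I k.+1 (x * y).
Proof.
move=> Ix [n [c [a [Ha ->]]]].
exists n, c, (fun i j => if unlift ord0 j is Some l then a i l else x).
split=> [i j|]; first by case: unliftP.
rewrite mulr_sumr; apply: eq_bigr => i _; rewrite big_ord_recl unlift_none mulrCA.
by congr (_ * (_ * _)); apply: eq_bigr => j _; rewrite liftK.
Qed.

Lemma ideal_pow1 (A : cring) (I : A -> Prop) x : I x -> ideal_pow I 1 x.
Proof. by move=> Ix; rewrite -[x]mulr1; apply: ideal_powM => //; apply: ideal_pow0. Qed.

Lemma ideal_pow_leS (A : cring) (I : A -> Prop) k x :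
  ideal_pow I k.+1 x -> ideal_pow I k x.
Proof.
(* The filtration is shifted by one; orders 0 and 1 both give the whole ring, so the first factor
   gains nothing. *)
move=> Hx; apply: (@ideal_pow_le_filtration _ I (fun l => ideal_pow I l.-1) k.+1) Hx => //.
- by move=> l; apply: ideal_pow_is_ideal.
- exact: ideal_pow0.
case=> [|l] u v Iu Hv; first exact: ideal_pow0.
exact: ideal_powM.
Qed.

Lemma ideal_pow_sub (A : cring) (I : A -> Prop) k x :
  is_ideal I -> ideal_pow I k.+1 x -> I x.
Proof.
move=> HI; apply: (@ideal_pow_le_filtration _ I (fun l => if l is 0 then fun=> True else I) k.+1).
- by case=> [|l].
- by [].
- by move=> l u v Iu _; apply: idealMr.
Qed.

Lemma ideal_pow_morph (A B : cring) (f : {rmorphism A -> B}) (I : A -> Prop) (J : B -> Prop) k x :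
  (forall y, I y -> J (f y)) -> ideal_pow I k x -> ideal_pow J k (f x).
Proof.
move=> HIJ [n [c [a [Ha ->]]]]; exists n, (f \o c), (fun i j => f (a i j)); split=> [i j|].
  exact: HIJ.
by rewrite rmorph_sum; apply: eq_bigr => i _; rewrite rmorphM rmorph_prod.
Qed.

Lemma ideal_pow_pow (A : cring) (I K : A -> Prop) n k x :
  (forall y, ideal_pow I n y -> K y) -> ideal_pow I (n * k) x -> ideal_pow K k x.
Proof.
move=> HIK; elim: k x => [|k IHk] x; first by move=> _; apply: ideal_pow0.
rewrite mulnS; apply: ideal_pow_addP; first exact: ideal_pow_is_ideal.
by move=> u v Hu Hv; apply: ideal_powM; [apply: HIK | apply: IHk].
Qed.

(** The cofactor of [x - y] in [x ^+ p - y ^+ p] is congruent to [p%:R * x ^+ p.-1] modulo [I],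
    hence lies in [I]. Raising further to the power [p ^ h.-1] only multiplies this difference. *)
Lemma ideal_subXX (A : cring) (I : A -> Prop) (p h k : nat) (x y : A) :
  prime p -> (0 < h)%N -> is_ideal I -> I p%:R -> ideal_pow I k.+1 (x - y) ->
  ideal_pow I k.+2 (x ^+ (p ^ h) - y ^+ (p ^ h)).
Proof.
move=> p_pr h_gt0 HI Ip Hxy; have HJ l := ideal_pow_is_ideal I l.
rewrite -(prednK h_gt0) expnS !exprM [X in ideal_pow _ _ X]subrXX.
apply: idealMr => //; rewrite subrXX mulrC; apply: ideal_powM => //.
have Ixy : I (x - y) by apply: ideal_pow_sub Hxy.
have -> : \sum_(i < p) x ^+ (p.-1 - i) * y ^+ i =
    \sum_(i < p) x ^+ (p.-1 - i) * (y ^+ i - x ^+ i) + p%:R * x ^+ p.-1.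
  rewrite mulr_natl -[in X in _ *+ X](card_ord p) -sumr_const -big_split /=.
  apply: eq_bigr => i _; rewrite mulrBr -exprD subnK ?subrK //.
  by rewrite -ltnS prednK ?prime_gt0.
apply: idealD => //; last exact: idealMr.
apply: ideal_sum => // i; apply: idealMl => //; rewrite subrXX; apply: idealMr => //.
exact: idealBC.
Qed.

Lemma ext_ideal_is_ideal (A B : cring) (f : {rmorphism A -> B}) (I : A -> Prop) :
  is_ideal (ext_ideal f I).
Proof.
split; [|split].
- by exists 0, (fun=> 0), (fun=> 0); split=> [[]//|]; rewrite big_ord0.
- move=> x y [n [c [a [Hc ->]]]] [m [d [b [Hd ->]]]].
  exists (n + m)%N, (fun i => match split i with inl j => c j | inr j => d j end),
    (fun i => match split i with inl j => a j | inr j => b j end).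
  split=> [i|]; first by case: (split i).
  by rewrite big_split_ord; congr (_ + _); apply: eq_bigr => i _;
    rewrite ?(unsplitK (inl i)) ?(unsplitK (inr i)).
- move=> r x [n [c [a [Hc ->]]]]; exists n, c, (fun i => r * a i); split=> //.
  by rewrite mulr_sumr; apply: eq_bigr => i _; rewrite mulrCA.
Qed.

Lemma mem_ext_ideal (A B : cring) (f : {rmorphism A -> B}) (I : A -> Prop) a :
  I a -> ext_ideal f I (f a).
Proof. by move=> Ia; exists 1, (fun=> a), (fun=> 1); rewrite big_ord1 mulr1. Qed.

Lemma ext_ideal_min (A B : cring) (f : {rmorphism A -> B}) (I : A -> Prop) (J : B -> Prop) x :
  is_ideal J -> (forall a, I a -> J (f a)) -> ext_ideal f I x -> J x.
Proof.
move=> HJ HI [n [a [y [Ha ->]]]]; apply: ideal_sum => // i.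
by apply: idealMr => //; apply: HI.
Qed.

Lemma ideal_pow_ext (A B : cring) (f : {rmorphism A -> B}) (I : A -> Prop) k x :
  ideal_pow (ext_ideal f I) k x -> ext_ideal f (ideal_pow I k) x.
Proof.
apply: (@ideal_pow_le_filtration _ _ (fun l => ext_ideal f (ideal_pow I l))).
- by move=> l; apply: ext_ideal_is_ideal.
- by rewrite -(rmorph1 f); apply: mem_ext_ideal; apply: ideal_pow0.
move=> l u v [n [a [y [Ha ->]]]] [m [b [z [Hb ->]]]].
rewrite mulr_suml; apply: ideal_sum => [|i]; first exact: ext_ideal_is_ideal.
rewrite mulr_sumr; apply: ideal_sum => [|j]; first exact: ext_ideal_is_ideal.
rewrite mulrACA -rmorphM; apply: idealMr; first exact: ext_ideal_is_ideal.
by apply: mem_ext_ideal; apply: ideal_powM.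
Qed.

(** * Base change of a finite free algebra *)

Section StructureConstants.
Variables (A : cring) (n : nat).

(** With [M] read as structure constants, this is the matrix of multiplication by the element with
    coordinates [x], acting on row vectors. *)
Definition mul_mx (M : 'I_n -> 'M[A]_n) (x : 'rV[A]_n) : 'M[A]_n :=
  \sum_i x 0 i *: M i.

Fact mul_mx_is_linear M : linear (mul_mx M).
Proof.
move=> a x y; rewrite /mul_mx scaler_sumr -big_split /=; apply: eq_bigr => i _.
by rewrite !mxE scalerDl scalerA.
Qed.
HB.instance Definition _ M := GRing.isLinear.Build A _ _ _ (mul_mx M) (mul_mx_is_linear M).

(* [M j] is the matrix of multiplication by the [j]-th basis vector and [u]
   holds the coordinates of [1]. *)
Record is_structure (M : 'I_n -> 'M[A]_n) (u : 'rV[A]_n) : Prop := IsStructure {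
  structureM : forall i j, mul_mx M (row i (M j)) = M i *m M j;
  structureC : forall i j, row i (M j) = row j (M i);
  structure1 : mul_mx M u = 1%:M }.

Variables (M : 'I_n -> 'M[A]_n) (u : 'rV[A]_n) (H : is_structure M u).

(** The phantom argument attaches the proof of the axioms to the type, so that a ring structure
    depending on it can be declared on row vectors. *)
Definition structure_alg (_ : is_structure M u) := 'rV[A]_n.
Notation E := (structure_alg H).
HB.instance Definition _ := GRing.Zmodule.on E.

Definition structure_mul (x y : 'rV[A]_n) : 'rV[A]_n := x *m mul_mx M y.

Lemma structure_mulE x y :
  structure_mul x y = \sum_i \sum_j (x 0 i * y 0 j) *: row i (M j).
Proof.
rewrite /structure_mul mulmx_sum_row; apply: eq_bigr => i _.
rewrite /mul_mx linear_sum scaler_sumr; apply: eq_bigr => j _.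
by rewrite linearZ scalerA.
Qed.

Fact structure_mulC : commutative structure_mul.
Proof.
move=> x y; rewrite !structure_mulE exchange_big; apply: eq_bigr => i _.
by apply: eq_bigr => j _; rewrite mulrC (structureC H).
Qed.

(** The regular representation is multiplicative: bilinearity reduces this to basis vectors, where
    it is [structureM]. Associativity of the product then follows from that of matrices. *)
Lemma mul_mxM x y : mul_mx M (structure_mul x y) = mul_mx M x *m mul_mx M y.
Proof.
rewrite structure_mulE linear_sum mulmx_suml; apply: eq_bigr => i _.
rewrite linear_sum mulmx_sumr; apply: eq_bigr => j _.
by rewrite linearZ /= (structureM H) -scalemxAl -scalemxAr scalerA.
Qed.

Fact structure_mulA : associative structure_mul.
Proof. by move=> x y z; rewrite /structure_mul -mulmxA -mul_mxM. Qed.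

Fact structure_mul1 : left_id u structure_mul.
Proof. by move=> x; rewrite structure_mulC /structure_mul (structure1 H) mulmx1. Qed.

Fact structure_mulDl : left_distributive structure_mul +%R.
Proof. by move=> x y z; rewrite /structure_mul mulmxDl. Qed.

HB.instance Definition _ := GRing.Zmodule_isComPzRing.Build E
  structure_mulA structure_mulC structure_mul1 structure_mulDl.

Lemma structure_algM (x y : E) : x * y = (x : 'rV[A]_n) *m mul_mx M y.
Proof. by []. Qed.

Definition structure_scalar (a : A) : E := a *: u.

Fact structure_scalar_zmod : zmod_morphism structure_scalar.
Proof. by move=> a b; rewrite /structure_scalar scalerBl. Qed.

Lemma structure_scalarM a (x : E) : structure_scalar a * x = a *: (x : 'rV[A]_n) :> 'rV[A]_n.
Proof. by rewrite /structure_scalar structure_algM -scalemxAl -/(structure_mul _ _) structure_mul1. Qed.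

Fact structure_scalar_monoid : monoid_morphism structure_scalar.
Proof.
split=> [|a b]; first by rewrite /structure_scalar scale1r.
by rewrite [RHS]structure_scalarM /structure_scalar scalerA.
Qed.

HB.instance Definition _ := GRing.isZmodMorphism.Build _ _ structure_scalar structure_scalar_zmod.
HB.instance Definition _ := GRing.isMonoidMorphism.Build _ _ structure_scalar structure_scalar_monoid.
End StructureConstants.

Lemma map_mul_mx (A C : cring) (g : {rmorphism A -> C}) n (M : 'I_n -> 'M[A]_n) x :
  mul_mx (fun i => map_mx g (M i)) (map_mx g x) = map_mx g (mul_mx M x).
Proof. by rewrite [RHS]raddf_sum; apply: eq_bigr => i _; rewrite /= map_mxZ mxE. Qed.

(** The axioms are polynomial identities in matrix entries, so any ring map preserves them. This is
    what makes base change of the algebra a ring. *)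
Lemma is_structure_map (A C : cring) (g : {rmorphism A -> C}) n (M : 'I_n -> 'M[A]_n) u :
  is_structure M u -> is_structure (fun i => map_mx g (M i)) (map_mx g u).
Proof.
case=> HM HC H1; split=> [i j|i j|].
- by rewrite -map_row map_mul_mx HM map_mxM.
- by rewrite -!map_row HC.
- by rewrite map_mul_mx H1 map_mx1.
Qed.

Lemma finite_free_coord (A B : cring) (f : {rmorphism A -> B}) : finite_free f ->
  exists (n : nat) (b : 'I_n -> B) (cv : B -> 'rV[A]_n),
    (forall y, \sum_i f (cv y 0 i) * b i = y) /\
    (forall c : 'rV[A]_n, cv (\sum_i f (c 0 i) * b i) = c).
Proof.
move=> [n [b /choice[c Hc]]]; exists n, b, (fun y => \row_i c y i); split=> [y|x].
  by rewrite [RHS](Hc y).1; apply: eq_bigr => i _; rewrite mxE.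
by apply/rowP => i; rewrite mxE -((Hc _).2 (fun i => x 0 i)).
Qed.

Section FreeBaseChange.
Variables (TP : tensor_choice) (A B C : cring) (f : {rmorphism A -> B}) (g : {rmorphism A -> C}).
Variables (n : nat) (b : 'I_n -> B) (cv : B -> 'rV[A]_n).
Hypothesis cvK : forall y, \sum_i f (cv y 0 i) * b i = y.
Hypothesis cv_sum : forall c : 'rV[A]_n, cv (\sum_i f (c 0 i) * b i) = c.
Local Notation T := (Tens TP f g).

Let cvB : zmod_morphism cv.
Proof.
move=> x y; rewrite -[in LHS](cvK x) -[in LHS](cvK y) -sumrB.
rewrite -[RHS]cv_sum; congr cv; apply: eq_bigr => i _.
by rewrite !mxE rmorphB mulrBl.
Qed.

Let cvL := GRing.isZmodMorphism.Build _ _ cv cvB.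
Let cva : {additive B -> 'rV[A]_n} := HB.pack cv cvL.

Let cv_fM a y : cv (f a * y) = a *: cv y.
Proof.
rewrite -[in LHS](cvK y) mulr_sumr -[RHS]cv_sum; congr cv; apply: eq_bigr => i _.
by rewrite mxE rmorphM mulrA.
Qed.

Let cv_bigD (F : 'I_n -> B) : cv (\sum_i F i) = \sum_i cv (F i).
Proof. exact: (raddf_sum cva). Qed.

Let cv_mulr x y : cv (x * y) = \sum_i cv x 0 i *: cv (b i * y).
Proof.
rewrite -[in LHS](cvK x) mulr_suml cv_bigD.
by apply: eq_bigr => i _; rewrite -mulrA cv_fM.
Qed.

Definition basis_mul_mx (j : 'I_n) : 'M[A]_n := \matrix_i cv (b i * b j).

Let mul_mx_cv y : mul_mx basis_mul_mx (cv y) = \matrix_l cv (b l * y).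
Proof.
apply/row_matrixP => l; rewrite linear_sum rowK mulrC cv_mulr; apply: eq_bigr => i _.
by rewrite linearZ /= rowK mulrC.
Qed.

(** [mul_mx_cv] identifies [mul_mx] at [cv y] with actual multiplication by [y] in [B], so the
    axioms are inherited from [B]. *)
Lemma basis_structure : is_structure basis_mul_mx (cv 1).
Proof.
split=> [i j|i j|].
- rewrite rowK mul_mx_cv; apply/row_matrixP => l; rewrite rowK row_mul rowK.
  rewrite mulmx_sum_row mulrA cv_mulr; apply: eq_bigr => k _.
  by rewrite rowK.
- by rewrite !rowK mulrC.
- rewrite mul_mx_cv; apply/row_matrixP => l; rewrite rowK mulr1 row1.
  rewrite -[RHS]cv_sum; congr cv; rewrite (bigD1 l) //= big1 => [|i il].
    by rewrite mxE !eqxx rmorph1 mul1r addr0.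
  by rewrite mxE (negPf il) andbF rmorph0 mul0r.
Qed.

Let H := is_structure_map g basis_structure.
Local Notation E := (structure_alg H).

Definition base_change_l (y : B) : E := map_mx g (cv y).

Fact base_change_l_zmod : zmod_morphism base_change_l.
Proof. by move=> x y; rewrite /base_change_l cvB map_mxB. Qed.

Fact base_change_l_monoid : monoid_morphism base_change_l.
Proof.
split=> // x y; rewrite structure_algM /base_change_l map_mul_mx -map_mxM.
congr map_mx; rewrite mul_mx_cv cv_mulr mulmx_sum_row.
by apply: eq_bigr => i _; rewrite rowK.
Qed.

HB.instance Definition _ := GRing.isZmodMorphism.Build _ _ base_change_l base_change_l_zmod.
HB.instance Definition _ := GRing.isMonoidMorphism.Build _ _ base_change_l base_change_l_monoid.

Fact base_change_comm a : base_change_l (f a) = structure_scalar H (g a).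
Proof. by rewrite /base_change_l -[f a]mulr1 cv_fM map_mxZ. Qed.

Definition tens_coord : {rmorphism T -> E} := tlift TP base_change_comm.

(** The inverse of [tens_coord], reassembling an element from its coordinates over [C] in the basis
    [b]. *)
Definition coord_tens (x : E) : T := \sum_i tinr TP f g (x 0 i) * tinl TP f g (b i).

Fact coord_tens_zmod : zmod_morphism coord_tens.
Proof.
move=> x y; rewrite /coord_tens -sumrB; apply: eq_bigr => i _.
by rewrite !mxE rmorphB mulrBl.
Qed.
HB.instance Definition _ := GRing.isZmodMorphism.Build _ _ coord_tens coord_tens_zmod.

Let coord_tensZ a (x : 'rV[C]_n) : coord_tens (a *: x) = tinr TP f g a * coord_tens x.
Proof. by rewrite mulr_sumr; apply: eq_bigr => i _; rewrite mxE rmorphM mulrA. Qed.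

Let coord_tens_cv y : coord_tens (map_mx g (cv y)) = tinl TP f g y.
Proof.
rewrite -[in RHS](cvK y) rmorph_sum; apply: eq_bigr => i _.
by rewrite mxE rmorphM tcomm.
Qed.

Fact coord_tens_monoid : monoid_morphism coord_tens.
Proof.
split=> [|x y]; first by rewrite [LHS]coord_tens_cv rmorph1.
rewrite [x * y]structure_mulE raddf_sum mulr_suml; apply: eq_bigr => i _.
rewrite raddf_sum mulr_sumr; apply: eq_bigr => j _.
by rewrite /= coord_tensZ -map_row rowK coord_tens_cv !rmorphM mulrACA.
Qed.
HB.instance Definition _ := GRing.isMonoidMorphism.Build _ _ coord_tens coord_tens_monoid.

Lemma tens_coordK : cancel tens_coord coord_tens.
Proof.
apply: (@po_uniq _ _ _ _ _ _ _ (coord_tens \o tens_coord) idfun) => [y|c] /=.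
  by rewrite [tens_coord _]tlift_l; apply: coord_tens_cv.
rewrite [tens_coord _]tlift_r /=.
by rewrite /structure_scalar coord_tensZ coord_tens_cv rmorph1 mulr1.
Qed.

(** Scalars from [I] act on coordinates through [g], so each factor taken from the extended ideal
    raises the order of every coordinate by one. *)
Lemma tens_coord_pow (I : A -> Prop) k z i :
  ideal_pow (ext_ideal (tinl TP f g \o f) I) k z ->
  ideal_pow (ext_ideal g I) k ((tens_coord z : 'rV[C]_n) 0 i).
Proof.
have HI l := ideal_pow_is_ideal (ext_ideal g I) l.
pose F l t := forall i, ideal_pow (ext_ideal g I) l ((tens_coord t : 'rV[C]_n) 0 i).
have HF l : is_ideal (F l).
  split=> [j|]; first by rewrite rmorph0 mxE; apply: ideal0.
  split=> [x y Hx Hy j|a x Hx j]; first by rewrite rmorphD mxE; apply: idealD.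
  (* With [x] as the row vector, multiplication by [a] only forms linear combinations of the
     coordinates of [x]. *)
  rewrite mulrC rmorphM structure_algM mxE; apply: ideal_sum => // l'.
  exact: idealMr.
move=> Hz; apply: (@ideal_pow_le_filtration _ _ F k z) Hz i => // [j|l x y].
  exact: ideal_pow0.
move=> [m [a [t [Ha ->]]]] Fy; rewrite mulr_suml; apply: ideal_sum => // j l'.
rewrite -mulrA rmorphM /= tcomm [tens_coord (tinr _ _ _ _)]tlift_r.
rewrite structure_scalarM mxE; apply: ideal_powM; first exact: mem_ext_ideal.
by have := idealMl (t j) (HF l) Fy; apply.
Qed.
End FreeBaseChange.

Lemma tens_free_separated (TP : tensor_choice) (A B C : cring) (f : {rmorphism A -> B})
    (g : {rmorphism A -> C}) (I : A -> Prop) (z : Tens TP f g) :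
  finite_free f ->
  (forall x, (forall k, ideal_pow (ext_ideal g I) k x) -> x = 0) ->
  (forall k, ideal_pow (ext_ideal (tinl TP f g \o f) I) k z) -> z = 0.
Proof.
move=> /finite_free_coord[n [b [cv [cvK cv_sum]]]] sepC Hz.
apply: (can_inj (tens_coordK cvK cv_sum)); rewrite rmorph0; apply/rowP => i; rewrite mxE.
by apply: sepC => k; apply: tens_coord_pow.
Qed.

(** * Nilpotence in the special fibre *)

(* Dividing by the first unit coefficient in a relation
   [c_0 + c_1 y_0 + c_2 y_0 y_1 + ... = 0] modulo [K] puts an initial product of
   the [y_j] in [K]. *)
Lemma prod_mem_of_relation (B : cring) (J K : B -> Prop) (n : nat) (c y : nat -> B) (e : B) :
  is_ideal J -> is_ideal K -> (forall x, ~ J x -> is_unit_elt x) ->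
  (forall i, (i <= n)%N -> K (c i) \/ ~ J (c i)) ->
  (exists2 i, (i <= n)%N & ~ J (c i)) -> (forall j, J (y j)) ->
  K (e * \sum_(i < n.+1) c i * \prod_(j < i) y j) -> K (e * \prod_(j < n) y j).
Proof.
move=> HJ HK HU; elim: n c y e => [|n IHn] c y e Hc [i0 i0n Hi0] Hy.
  move: i0n Hi0; rewrite leqn0 => /eqP-> /HU[z Hz].
  by rewrite big_ord1 !big_ord0 mulr1 => Kc; rewrite -Hz mulrA; apply: idealMr.
set s := \sum_(i < n.+1) c (i.+1) * \prod_(j < i) y j.+1.
have -> : \sum_(i < n.+2) c i * \prod_(j < i) y j = c 0%N + y 0%N * s.
  rewrite big_ord_recl big_ord0 mulr1; congr (_ + _).
  by rewrite mulr_sumr; apply: eq_bigr => i _; rewrite lift0 big_ord_recl mulrCA.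
move=> Ks; have [Jc0|Jc0] := EM (J (c 0%N)); last first.
  have [z Hz] : is_unit_elt (c 0%N + y 0%N * s).
    apply: HU => Hs; apply: Jc0; rewrite -(addrK (y 0%N * s) (c _)).
    by apply: (idealB HJ) => //; apply: (idealMr _ HJ).
  apply: (idealMr _ HK); rewrite -[e]mulr1 -Hz mulrA; exact: (idealMr _ HK).
rewrite big_ord_recl mulrA; apply: (IHn (fun i => c i.+1) (fun j => y j.+1)) => //.
- by move=> i ?; apply: Hc.
- by case: i0 i0n Hi0 => [//|i] ? ?; exists i.
have [Kc0|//] := Hc 0%N isT; rewrite -mulrA -(addKr (c 0%N) (y 0%N * s)) mulrDr.
by apply: (idealD HK) => //; apply: (idealMl _ HK); apply: (idealN HK).
Qed.

Lemma wide_kernel (F : fieldType) (n : nat) (M : 'M[F]_(n.+1, n)) :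
  exists2 v : 'rV[F]_n.+1, v != 0 & v *m M = 0.
Proof.
exists (nz_row (kermx M)); last by apply/sub_kermxP; apply: nz_row_sub.
rewrite nz_row_eq0 -mxrank_eq0 mxrank_ker -lt0n subn_gt0.
by apply: leq_ltn_trans (rank_leq_col M) _.
Qed.

(* With [n] the rank, [1, y_0, y_0 y_1, ...] are [n+1] vectors in the
   [n]-dimensional special fibre, hence dependent. *)
Lemma finite_free_nilpotent (A B : cring) (F : fieldType) (f : {rmorphism A -> B})
    (res : {rmorphism A -> F}) (I : A -> Prop) (J : B -> Prop) :
  finite_free f -> is_ideal I -> (forall x, I x <-> res x = 0) ->
  (forall z, exists x, res x = z) -> is_ideal J ->
  (forall x, ~ J x -> is_unit_elt x) -> (forall a, J (f a) -> I a) ->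
  exists n, forall y, ideal_pow J n y -> ext_ideal f I y.
Proof.
move=> /finite_free_coord[n [b [cv [cvK _]]]] HI Ires /choice[s sK] HJ HU HfJ.
have HK := ext_ideal_is_ideal f I.
exists n => _ [m [d [a [Ha ->]]]]; apply: ideal_sum => // i0; apply: idealMl => //.
move: {d a Ha}(a i0) (Ha i0) => a Ja.
(* The finite family is continued by 0, which lies in [J], to the sequence that
   [prod_mem_of_relation] takes. *)
pose y j := if insub j is Some i then a i else 0.
have Jy j : J (y j) by rewrite /y; case: insub => [i|]; [exact: Ja | exact: ideal0].
have -> : \prod_(j < n) a j = \prod_(j < n) y j.
  by apply: eq_bigr => j _; rewrite /y valK.
pose e i := \prod_(j < i) y j.
have [v v0 vM] := wide_kernel (\matrix_(i < n.+1, k < n) res (cv (e i) 0 k)).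
pose c i := f (s (v 0 (inord i))).
rewrite -[\prod_(j < n) _]mul1r; apply: (@prod_mem_of_relation _ J _ _ c) => //.
- move=> i _; have [Jc|] := EM (J (c i)); last by right.
  by left; apply: mem_ext_ideal; apply: HfJ.
- have /rV0Pn[i vi] := v0; exists i => [|Jc]; first by rewrite -ltnS.
  by move: vi; rewrite -[v 0 i]sK -(inord_val i) (Ires _).1 ?eqxx //; apply: HfJ.
rewrite mul1r.
(* Expanded in the basis, the combination has coordinates whose residues are the entries of [v]
   times the matrix, hence zero. *)
have -> : \sum_(i < n.+1) c i * e i =
    \sum_(k < n) f (\sum_(i < n.+1) s (v 0 i) * cv (e i) 0 k) * b k.
  under [RHS]eq_bigr do rewrite rmorph_sum mulr_suml.
  rewrite exchange_big; apply: eq_bigr => i _; rewrite -[in LHS](cvK (e i)) mulr_sumr.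
  by apply: eq_bigr => k _; rewrite rmorphM mulrA /c inord_val.
apply: ideal_sum => // k; apply: idealMr => //; apply: mem_ext_ideal.
rewrite Ires rmorph_sum; transitivity ((v *m \matrix_(i < n.+1, k < n) res (cv (e i) 0 k)) 0 k).
  by rewrite mxE; apply: eq_bigr => i _; rewrite rmorphM sK !mxE.
by rewrite vM mxE.
Qed.

(** * Sheaves and the Adams operation *)

Lemma tens_ext (TP : tensor_choice) (A B C D : cring) (f : {rmorphism A -> B})
    (g : {rmorphism A -> C}) (w w' : {rmorphism Tens TP f g -> D}) :
  (forall b, w (tinl TP f g b) = w' (tinl TP f g b)) ->
  (forall c, w (tinr TP f g c) = w' (tinr TP f g c)) -> w =1 w'.
Proof. exact: po_uniq. Qed.

Section Sheaves.
Variables (TP : tensor_choice) (L : LTdata TP).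

Local Notation O := (O L).
Local Notation Od := (Od L).
Local Notation mO := (@mO _ L).
Local Notation mOd d := (@mOd _ L d).
Local Notation src := (src L).
Local Notation tgt := (tgt L).
Local Notation p := (lt_p L).
Local Notation h := (lt_h L).

Let mO_res a : mO a <-> resO L a = 0.
Proof. by have [_ [_ [_ [H _]]]] := O_cl L. Qed.

Let mO_ideal : is_ideal mO.
Proof. by have [] := O_cl L. Qed.

Let mOd_res d x : mOd d x <-> resOd L d x = 0.
Proof. by have [_ [_ [_ [H _]]]] := Od_cl L d. Qed.

Let mOd_ideal d : is_ideal (mOd d).
Proof. by have [] := Od_cl L d. Qed.

Let mOd_unit d x : ~ mOd d x -> is_unit_elt x.
Proof. by have [_ [_ [H _]]] := Od_cl L d; apply: H. Qed.

Let resOd_src d a : resOd L d (src d a) = resO L a.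
Proof. by apply: nu_res; apply: nu_src. Qed.

Lemma mOd_tgt d a : mO a -> mOd d (tgt d a).
Proof.
move=> /mO_res ra; apply/mOd_res; rewrite (nu_res (nu_tgt d a)) rmorphXn ra.
by rewrite expr0n expn_eq0 -leqn0 leqNgt prime_gt0 // lt_p_prime.
Qed.

Lemma mOd_p d : mOd d p%:R.
Proof.
apply/mOd_res; rewrite rmorph_nat; exact: pcharf0 (kappa_char L).
Qed.

Lemma mOd_nu_ker d x : nu L d x = 0 -> mOd d x.
Proof.
by move=> nx; apply/mOd_res; rewrite (@nu_res _ L _ _ 0) ?rmorph0.
Qed.

(* [src] splits [q], so a value of [q] on [mOd] outside [mO] would put a unit
   in [mOd] plus the kernel of [q]. *)
Lemma mO_q x : mOd h x -> mO (q L x).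
Proof.
move=> mx; have [//|nm] := EM (mO (q L x)).
have : mOd h (x - src h (q L x)).
  have [//|/mOd_unit[y Hy]] := EM (mOd h (x - src h (q L x))).
  have := congr1 (q L) Hy; rewrite rmorphM rmorphB q_src subrr mul0r rmorph1 => /esym O10.
  have [_ [n1 _]] := O_cl L; case: n1.
  by rewrite O10; apply: ideal0.
move=> Hx; case: nm; apply/mO_res; rewrite -(resOd_src h); apply/mOd_res.
by rewrite -(subKr x (src h (q L x))); apply: idealB.
Qed.

(** Since [u] kills the kernel of the surjection [nu L d], it factors through [Op], and the lift
    factors through [nu_id], where the congruence applies. *)
Lemma frobenius_congruence_lift (R : qc_sheaf L) (d : nat) (D : cring)
    (u : {rmorphism Od d -> D}) (v : {rmorphism sh_car R -> D})
    (Huv : forall a, u (src d a) = v (sh_iota R a)) (x : sh_car R) :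
  frobenius_congruence R -> (forall y, nu L d y = 0 -> u y = 0) ->
  tlift TP Huv (sh_nab R d x) = v x ^+ (p ^ d).
Proof.
move=> HR Hu; have [w Hw] := rmorphism_factor (@nu_surj _ L d) Hu.
have Hwv a : w (quotp L a) = v (sh_iota R a) by rewrite -(nu_src d) Hw.
transitivity (tlift TP Hwv (nu_id R d (sh_nab R d x))).
  apply: (tens_ext (w' := tlift TP Hwv \o nu_id R d)) => [y|y] /=.
    by rewrite /nu_id !tlift_l /= ?tlift_l Hw.
  by rewrite /nu_id !tlift_r.
by rewrite HR tlift_r rmorphXn.
Qed.

Fact q_id_compat (R : qc_sheaf L) a : (sh_iota R \o q L) (src h a) = idfun (sh_iota R a).
Proof. by rewrite /= q_src. Qed.

Definition q_id (R : qc_sheaf L) : {rmorphism Tens TP (src h) (sh_iota R) -> sh_car R} :=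
  tlift TP (@q_id_compat R).

(** The lifts inside [psi_sh] and [q_id] may carry different compatibility proofs; agreement on both
    tensor factors identifies them. *)
Lemma psi_shE (R : qc_sheaf L) x : psi_sh R x = q_id R (sh_nab R h x).
Proof. by apply: tens_ext => y; rewrite ?tlift_l ?tlift_r. Qed.

Lemma psi_sh_iota (R : qc_sheaf L) a : psi_sh R (sh_iota R a) = sh_iota R (psiO L a).
Proof. by rewrite /psi_sh /= sh_nab_iota tlift_l /= q_tgt. Qed.

(** By [mOd_nu_ker] and [mO_q], [q] sends the kernel of [nu L h] into [mO], so the Frobenius
    congruence at height [h] can be pushed along [q] modulo [mS R]. *)
Lemma psi_sh_frob (R : qc_sheaf L) : frobenius_congruence R ->
  forall x, mS R (psi_sh R x - x ^+ (p ^ h)).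
Proof.
move=> HR x; have [Q [pi Hpi]] := ideal_quotient (ext_ideal_is_ideal (sh_iota R) mO).
apply/Hpi; rewrite psi_shE rmorphB rmorphXn; apply/eqP; rewrite subr_eq0; apply/eqP.
have Huv a : (pi \o (sh_iota R \o q L)) (src h a) = pi (sh_iota R a) by rewrite /= q_src.
rewrite -(frobenius_congruence_lift Huv x HR) => [|y /mOd_nu_ker/mO_q my].
  apply: (tens_ext (w := pi \o q_id R)) => y.
    by rewrite /= !tlift_l.
  by rewrite /= !tlift_r.
by rewrite /= Hpi; apply: mem_ext_ideal.
Qed.

Lemma psi_tens_compat (R : qc_sheaf L) d a :
  (tinl TP (src d) (sh_iota R) \o psiOd L d) (src d a) =
  (tinr TP (src d) (sh_iota R) \o psi_sh R) (sh_iota R a).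
Proof. by rewrite /= psiOd_src tcomm -psi_sh_iota. Qed.

Definition psi_tens (R : qc_sheaf L) d :
    {rmorphism Tens TP (src d) (sh_iota R) -> Tens TP (src d) (sh_iota R)} :=
  tlift TP (@psi_tens_compat R d).

(** The heights [h + d] and [d + h] index different types, so a cast relates them; with [n] a
    variable, [E] can be destructed. *)
Lemma sh_nab_cast (R : qc_sheaf L) m n (E : m = n) (D : cring)
    (u : {rmorphism Od m -> D}) (v : {rmorphism Od n -> D}) (w : {rmorphism sh_car R -> D})
    (Hu : forall a, u (src m a) = w (sh_iota R a))
    (Hv : forall a, v (src n a) = w (sh_iota R a)) x :
  (forall y, u y = v (eq_rect m (fun k => Od k : Type) y n E)) ->
  tlift TP Hu (sh_nab R m x) = tlift TP Hv (sh_nab R n x).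
Proof.
move: E v Hv => E; case: n / E => v Hv Huv.
by apply: tens_ext => y; rewrite ?tlift_l ?tlift_r ?Huv.
Qed.

(** Coassociativity rewrites the two sides through the coactions at heights [h + d] and [d + h];
    [q_nab] then identifies the results. *)
Lemma sh_nab_psi (R : qc_sheaf L) d x :
  sh_nab R d (psi_sh R x) = psi_tens R d (sh_nab R d x).
Proof.
pose T := Tens TP (src d) (sh_iota R); pose inl : {rmorphism Od d -> T} := tinl TP _ _.
pose inr : {rmorphism sh_car R -> T} := tinr TP _ _.
have H1 a : (inl \o (tgt d \o q L)) (src h a) = idfun (jt (sh_iota R) d a).
  by rewrite /= q_src.
have H2 a : (inl \o psiOd L d) (src d a) = (inr \o q_id R) (jt (sh_iota R) h a).
  by rewrite /= psiOd_src [q_id R _]tlift_l /= q_tgt; apply: tcomm.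
have -> : sh_nab R d (psi_sh R x) =
    tlift TP H1 (id_nab (@sh_nab_iota _ _ R) h d (sh_nab R h x)).
  rewrite psi_shE; apply: (tens_ext (w := sh_nab R d \o q_id R)
    (w' := tlift TP H1 \o id_nab (@sh_nab_iota _ _ R) h d)) => y /=.
    by rewrite /q_id /id_nab !tlift_l /= sh_nab_iota.
  by rewrite /q_id /id_nab !tlift_r /= ?tlift_r.
have -> : psi_tens R d (sh_nab R d x) =
    tlift TP H2 (id_nab (@sh_nab_iota _ _ R) d h (sh_nab R d x)).
  apply: (tens_ext (w' := tlift TP H2 \o id_nab (@sh_nab_iota _ _ R) d h)) => y /=.
    by rewrite /psi_tens /id_nab !tlift_l.
  by rewrite /psi_tens /id_nab !tlift_r /= ?tlift_r /=; exact: (congr1 inr (psi_shE y)).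
rewrite !sh_coassoc.
(* [G1] and [G2] are the two lifts that appear in [q_nab], restated to match it syntactically. *)
pose G1 : {rmorphism Tens TP (src h) (tgt d) -> Od d} :=
  @tlift TP O (Od h) (Od d) (Od d) (src h) (tgt d) (tgt d \o q L) idfun
    (fun a => f_equal (tgt d) (q_src a)).
pose G2 : {rmorphism Tens TP (src d) (tgt h) -> Od d} :=
  @tlift TP O (Od d) (Od h) (Od d) (src d) (tgt h) (psiOd L d) (src d \o q L)
    (fun a => etrans (psiOd_src d a) (f_equal (src d) (esym (q_tgt a)))).
have H3 a : (inl \o (G1 \o nab L h d)) (src (h + d) a) = inr (sh_iota R a).
  by rewrite /= nab_src /G1 tlift_r; apply: tcomm.
have H4 a : (inl \o (G2 \o nab L d h)) (src (d + h) a) = inr (sh_iota R a).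
  by rewrite /= nab_src /G2 tlift_r /= q_src; apply: tcomm.
transitivity (tlift TP H3 (sh_nab R (h + d) x)).
  apply: (tens_ext (w := tlift TP H1 \o (tassoc (sh_iota R) h d \o nab_id (sh_iota R) h d)))
    => y /=; last by rewrite /nab_id /tassoc !tlift_r /= ?tlift_r.
  rewrite /nab_id tlift_l /= /tassoc !tlift_l /=.
  apply: (tens_ext (w := tlift TP H1 \o assoc_X (sh_iota R) h d) (w' := inl \o G1)) => z /=.
    by rewrite /assoc_X /G1 !tlift_l.
  by rewrite /assoc_X /G1 !tlift_r /= ?tlift_r.
transitivity (tlift TP H4 (sh_nab R (d + h) x)).
  apply: (sh_nab_cast (E := addnC h d)) => y.
  exact: (congr1 inl (q_nab y)).
apply: esym; apply: (tens_ext (w := tlift TP H2 \o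
    (tassoc (sh_iota R) d h \o nab_id (sh_iota R) d h)))
  => y /=; last by rewrite /nab_id /tassoc !tlift_r /= ?tlift_r /= /q_id ?tlift_r.
rewrite /nab_id tlift_l /= /tassoc !tlift_l /=.
apply: (tens_ext (w := tlift TP H2 \o assoc_X (sh_iota R) d h) (w' := inl \o G2)) => z /=.
  by rewrite /assoc_X /G2 !tlift_l.
rewrite /assoc_X /G2 !tlift_r /= ?tlift_r /= /q_id ?tlift_l /=; apply/esym; exact: tcomm.
Qed.

(** * Equivariant maps that agree modulo an ideal *)

Section Agreement.
Variables (R : qc_sheaf L) (T : cring) (J : T -> Prop) (f g : {rmorphism sh_car R -> T}).
Hypotheses (HR : frobenius_congruence R) (HJ : is_ideal J) (Jp : J p%:R).
Hypothesis fgO : forall a, f (sh_iota R a) = g (sh_iota R a).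
Hypothesis fJ : forall a, mO a -> J (f (sh_iota R a)).

Lemma psi_sh_contraction k :
  (forall x, ideal_pow J k.+1 (f x - g x)) ->
  forall x, ideal_pow J k.+2 (f (psi_sh R x) - g (psi_sh R x)).
Proof.
move=> Hfg x; have HJk l := ideal_pow_is_ideal J l.
rewrite -(subrK (x ^+ (p ^ h)) (psi_sh R x)); move: (psi_sh_frob HR x).
move: (_ - _) => _ [n [a [r [Ha ->]]]].
rewrite !rmorphD opprD addrACA !rmorphXn; apply: idealD => //; last first.
  by apply: ideal_subXX; rewrite ?lt_p_prime ?lt_h_pos.
(* As [f] and [g] agree on scalars, each term differs by an element of [J] times a difference of
   order [k.+1]. *)
rewrite !rmorph_sum -sumrB; apply: ideal_sum => // i.
rewrite !rmorphM -fgO -mulrBr; apply: ideal_powM; [exact: fJ | exact: Hfg].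
Qed.

Lemma psi_sh_equivariant_agree (psiT : T -> T) :
  (forall k x y, ideal_pow J k (psiT x - psiT y) -> ideal_pow J k (x - y)) ->
  (forall x, f (psi_sh R x) = psiT (f x)) ->
  (forall x, g (psi_sh R x) = psiT (g x)) ->
  (forall x, J (f x - g x)) -> forall k x, ideal_pow J k (f x - g x).
Proof.
(* Order 0 is vacuous and the contraction needs order at least 1, so the induction starts from
   [Hfg]. *)
move=> HT Hf Hg Hfg [|k]; first by move=> x; apply: ideal_pow0.
elim: k => [|k IHk] x; first by apply: ideal_pow1.
by apply: HT; rewrite -Hf -Hg; apply: psi_sh_contraction.
Qed.
End Agreement.

(** Compatibility with the coaction at height [h], followed by [q]; it makes the uniqueness argument
    apply to every sheaf morphism. *)
Lemma sheaf_morphism_psi (R S : qc_sheaf L) (f : {rmorphism sh_car R -> sh_car S}) x :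
  sheaf_morphism f -> f (psi_sh R x) = psi_sh S (f x).
Proof.
move=> [Hf Hnab]; rewrite !psi_shE Hnab.
apply: (tens_ext (w := f \o q_id R) (w' := q_id S \o id_tens Hf h)) => y /=.
  by rewrite /q_id /id_tens !tlift_l /= Hf.
by rewrite /q_id /id_tens !tlift_r /= ?tlift_r.
Qed.

(** Were [g x] outside the maximal ideal it would be a unit, and so would its image [x] under
    [psiOd]. *)
Lemma psiOd_inv_ideal d (g : {rmorphism Od d -> Od d}) :
  cancel g (psiOd L d) -> forall x, mOd d x -> mOd d (g x).
Proof.
move=> gK x mx; have [//|/mOd_unit[y Hy]] := EM (mOd d (g x)).
have [_ [n1 _]] := Od_cl L d; case: n1.
have := congr1 (psiOd L d) Hy; rewrite rmorphM gK rmorph1 => <-.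
exact: idealMr.
Qed.

(** * Compatibility of equivariant maps with the coaction *)

Section TensorAgreement.
Variables (R S : qc_sheaf L) (f : {rmorphism sh_car R -> sh_car S}) (d : nat).
Hypotheses (HR : frobenius_congruence R) (HS : frobenius_congruence S).
Hypothesis sepS : forall x, (forall k, ideal_pow (mS S) k x) -> x = 0.
Hypothesis psiS_bij : bijective (psi_sh S).
Hypothesis Hf : forall a, f (sh_iota R a) = sh_iota S a.
Hypothesis fpsi : forall x, f (psi_sh R x) = psi_sh S (f x).

Local Notation T := (Tens TP (src d) (sh_iota S)).
Local Notation J := (ext_ideal (tinl TP (src d) (sh_iota S)) (mOd d)).

Let HJ : is_ideal J.
Proof. exact: ext_ideal_is_ideal. Qed.

Lemma tens_separated (z : T) : (forall k, ideal_pow J k z) -> z = 0.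
Proof.
move=> Hz.
have [n Hn] : exists n, forall y, ideal_pow (mOd d) n y -> ext_ideal (src d) mO y.
  apply: (@finite_free_nilpotent _ _ _ _ (resO L)) => //; first exact: src_free.
  - by have [_ [_ [_ [_ []]]]] := O_cl L.
  - exact: mOd_unit.
  - by move=> a /mOd_res; rewrite resOd_src => /mO_res.
apply: (tens_free_separated (I := mO)) => //; first exact: src_free.
(* Every [n] factors from the extension of [mOd d] give one factor from the extension of [mO], so
   order [n * k] for the former yields order [k] for the latter. *)
move=> k; apply: (ideal_pow_pow (n := n)) (Hz (n * k)%N) => y /ideal_pow_ext.
apply: ext_ideal_min => [|b /Hn]; first exact: ext_ideal_is_ideal.
move=> [m [a [c [Ha ->]]]]; rewrite rmorph_sum.
apply: ideal_sum => [|i]; first exact: ext_ideal_is_ideal.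
rewrite rmorphM; apply: idealMr; first exact: ext_ideal_is_ideal.
exact: (mem_ext_ideal (tinl TP (src d) (sh_iota S) \o src d)).
Qed.

(** [psi_tens] has a left inverse, the tensor product of the inverses of [psiOd] and [psi_sh S], and
    this inverse maps [J] into itself. *)
Lemma psi_tens_reflect k (x y : T) :
  ideal_pow J k (psi_tens S d x - psi_tens S d y) -> ideal_pow J k (x - y).
Proof.
have [gd [gdK Kgd]] := inverse_rmorphism (psiOd_bij L d).
have [gS [gSK KgS]] := inverse_rmorphism psiS_bij.
have [gO _ gOK] := psiO_bij L.
have Hg a : (tinl TP (src d) (sh_iota S) \o gd) (src d a) =
            (tinr TP (src d) (sh_iota S) \o gS) (sh_iota S a).
  by rewrite -(gOK a) /= -psiOd_src gdK -psi_sh_iota gSK; apply: tcomm.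
pose G := tlift TP Hg.
have GK : cancel (psi_tens S d) G.
  apply: (tens_ext (w := G \o psi_tens S d) (w' := idfun)) => z /=.
    by rewrite /psi_tens /G !tlift_l /= ?tlift_l /= gdK.
  by rewrite /psi_tens /G !tlift_r; apply: (congr1 (tinr TP (src d) (sh_iota S)) (gSK z)).
rewrite -{2}(GK x) -{2}(GK y) -!rmorphB; apply: ideal_pow_morph => z.
apply: (@ext_ideal_min _ _ _ _ (fun z => J (G z))); first exact: ideal_preimage.
move=> b mb; rewrite /G tlift_l; apply: mem_ext_ideal; exact: (psiOd_inv_ideal Kgd).
Qed.

Lemma id_tens_psi z : id_tens Hf d (psi_tens R d z) = psi_tens S d (id_tens Hf d z).
Proof.
apply: (tens_ext (w := id_tens Hf d \o psi_tens R d)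
  (w' := psi_tens S d \o id_tens Hf d)) => y /=.
  by rewrite /psi_tens /id_tens !tlift_l /= ?tlift_l.
rewrite /psi_tens /id_tens !tlift_r [in LHS]/comp ?tlift_r.
exact: (congr1 (tinr TP (src d) (sh_iota S)) (fpsi y)).
Qed.

(* Modulo [mOd d] both sides become the [p ^ d]-th power map. *)
Lemma sh_nab_agree_mod x : J (sh_nab S d (f x) - id_tens Hf d (sh_nab R d x)).
Proof.
have [Q [pi Hpi]] := ideal_quotient HJ.
apply/Hpi; rewrite rmorphB; apply/eqP; rewrite subr_eq0; apply/eqP.
pose u := pi \o tinl TP (src d) (sh_iota S).
pose v := pi \o tinr TP (src d) (sh_iota S).
have Hu y : nu L d y = 0 -> u y = 0.
  by move=> /mOd_nu_ker my; apply/Hpi; apply: mem_ext_ideal.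
have HuS a : u (src d a) = v (sh_iota S a) by rewrite /u /v /= tcomm.
have HuR a : u (src d a) = (v \o f) (sh_iota R a) by rewrite HuS /= Hf.
transitivity (v (f x) ^+ (p ^ d)).
  rewrite -(frobenius_congruence_lift HuS _ HS Hu).
  by apply: (tens_ext (w := pi)) => y; rewrite ?tlift_l ?tlift_r.
rewrite -[v (f x)]/((v \o f) x) -(frobenius_congruence_lift HuR _ HR Hu).
apply: (tens_ext (w := tlift TP HuR) (w' := pi \o id_tens Hf d)) => y.
  by rewrite /= /id_tens !tlift_l.
by rewrite /= /id_tens !tlift_r.
Qed.

Lemma psi_sh_equivariant_nab x : sh_nab S d (f x) = id_tens Hf d (sh_nab R d x).
Proof.
apply/eqP; rewrite -subr_eq0; apply/eqP; apply: tens_separated => k.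
apply: (@psi_sh_equivariant_agree R T J (sh_nab S d \o f) (id_tens Hf d \o sh_nab R d)
  HR HJ _ _ _ (psi_tens S d)) => //=.
- by rewrite -(rmorph_nat (tinl TP (src d) (sh_iota S))); apply: mem_ext_ideal; apply: mOd_p.
- by move=> a; rewrite Hf !sh_nab_iota /id_tens tlift_l.
- by move=> a ma; rewrite Hf sh_nab_iota; apply: mem_ext_ideal; apply: mOd_tgt.
- exact: psi_tens_reflect.
- by move=> y; rewrite fpsi sh_nab_psi.
- by move=> y; rewrite sh_nab_psi id_tens_psi.
- exact: sh_nab_agree_mod.
Qed.
End TensorAgreement.

End Sheaves.
(** * Adic limits of ring maps *)

(** Limits are chosen pointwise; the ring laws hold at each stage [f k], hence modulo every power of
    [I], and separatedness makes them exact. *)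
Lemma adic_limit_rmorphism (A B : cring) (I : B -> Prop) (f : nat -> {rmorphism A -> B}) :
  adic_complete I -> (forall k x, ideal_pow I k (f k.+1 x - f k x)) ->
  exists g : {rmorphism A -> B}, forall k x, ideal_pow I k (g x - f k x).
Proof.
move=> [sep lim] Hf; have HI k := ideal_pow_is_ideal I k.
have [g Hg] := choice (fun x => lim (fun k => f k x) (fun k => Hf k x)).
have eq_sep x y : (forall k, exists2 z, ideal_pow I k (x - z) & ideal_pow I k (y - z)) -> x = y.
  move=> Hxy; apply/eqP; rewrite -subr_eq0; apply/eqP/sep => k.
  have [z Hx Hy] := Hxy k; apply: (ideal_trans (y := z)) => //; exact: idealBC.
have ga : zmod_morphism g.
  move=> x y; apply: eq_sep => k; exists (f k (x - y)) => //.
  have -> : g x - g y - f k (x - y) = (g x - f k x) - (g y - f k y).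
    by rewrite rmorphB !opprB !addrA addrAC [RHS]addrAC; congr (_ + _); apply: addrAC.
  exact: idealB.
have gm : monoid_morphism g.
  split=> [|x y]; apply: eq_sep => k.
    by exists (f k 1) => //; rewrite rmorph1 subrr; apply: ideal0.
  exists (f k (x * y)) => //; rewrite rmorphM.
  have -> : g x * g y - f k x * f k y = (g x - f k x) * g y + f k x * (g y - f k y).
    by rewrite mulrBl mulrBr subrKA.
  by apply: idealD => //; [apply: idealMr | apply: idealMl].
pose gaM := GRing.isZmodMorphism.Build _ _ g ga.
pose gmM := GRing.isMonoidMorphism.Build _ _ g gm.
pose G : {rmorphism A -> B} := HB.pack g gaM gmM.
by exists G.
Qed.

(** * Existence and uniqueness of the lift *)

Theorem theorem4p1 (TP : tensor_choice) (L : LTdata TP) (R S : qc_sheaf L)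
  (HR : frobenius_congruence R) (HS : frobenius_congruence S)
  (HSobj : Cph_object (lt_p L) (lt_h L) (mS S) (psi_sh S))
  (HScomp : Cph_complete (mS S))
  (HSperf : Cph_perfect (mS S) (psi_sh S))
  (mu : {rmorphism sh_car R -> sh_car S})
  (Hmu : forall a, mu (sh_iota R a) = sh_iota S a) :
  exists muh : {rmorphism sh_car R -> sh_car S},
    (sheaf_morphism muh /\ forall x, mS S (muh x - mu x)) /\
    forall nu' : {rmorphism sh_car R -> sh_car S},
      sheaf_morphism nu' /\ (forall x, mS S (nu' x - mu x)) -> nu' =1 muh.
Proof.
have [HI [Ip Ifrob]] := HSobj; have [bij_psi [psi_I psi_I_onto]] := HSperf.
have HIk k := ideal_pow_is_ideal (mS S) k.
have [chi [psiK chiK]] := inverse_rmorphism bij_psi.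
have chi_I x : mS S x -> mS S (chi x).
  by move=> /psi_I_onto[y [Iy <-]]; rewrite psiK.
have iota_I a : mO a -> mS S (sh_iota S a) by apply: mem_ext_ideal.
have sep x y : (forall k, ideal_pow (mS S) k (x - y)) -> x = y.
  by move=> Hxy; apply/eqP; rewrite -subr_eq0; apply/eqP/HScomp.1.
pose step (g : {rmorphism sh_car R -> sh_car S}) : {rmorphism sh_car R -> sh_car S} :=
  chi \o (g \o psi_sh R).
pose f k := iter k step mu.
have fO k a : f k (sh_iota R a) = sh_iota S a.
  elim: k a => [|k IHk] a; first exact: Hmu.
  by rewrite [LHS](_ : _ = chi (f k (psi_sh R (sh_iota R a)))) // psi_sh_iota IHk
    -psi_sh_iota psiK.
have fpsi k x : f k (psi_sh R x) = psi_sh S (f k.+1 x) by exact/esym/chiK.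
have chi_pow k x : ideal_pow (mS S) k x -> ideal_pow (mS S) k (chi x).
  exact: ideal_pow_morph.
have f_cauchy k x : ideal_pow (mS S) k.+1 (f k.+1 x - f k x).
  elim: k x => [|k IHk] x.
    (* After [psi_sh S], the two terms become [f 0 (psi x)] and [psi (f 0 x)], both congruent to the
       [p ^ h]-th power of [f 0 x]; [chi] preserves [mS S]. *)
    apply: ideal_pow1; rewrite -(psiK (f 1%N x - f 0%N x)) rmorphB -fpsi; apply: chi_I.
    apply: (ideal_trans (y := f 0%N x ^+ (lt_p L ^ lt_h L))) => //; last exact: idealBC.
    rewrite -rmorphXn -rmorphB.
    apply: (@ext_ideal_min _ _ _ _ (fun z => mS S (f 0%N z))) (psi_sh_frob HR x) => [|a ma].
      exact: ideal_preimage.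
    by rewrite fO; apply: iota_I.
  rewrite -(psiK (f k.+2 x - f k.+1 x)) rmorphB -!fpsi; apply: chi_pow.
  apply: psi_sh_contraction => // a; first by rewrite !fO.
  by rewrite fO; apply: iota_I.
have [muh Hmuh] := adic_limit_rmorphism HScomp (fun k x => ideal_pow_leS (f_cauchy k x)).
have muhO a : muh (sh_iota R a) = sh_iota S a.
  by apply: sep => k; rewrite -(fO k a).
have muh_psi x : muh (psi_sh R x) = psi_sh S (muh x).
  (* Precomposing stage [k] with [psi_sh R] gives [psi_sh S] after stage [k.+1], and both stages are
     within order [k] of the limit. *)
  apply: sep => k; apply: (ideal_trans (y := f k (psi_sh R x))) => //.
  rewrite fpsi -rmorphB; apply: (ideal_pow_morph psi_I); apply: (idealBC (HIk k)).
  exact: ideal_pow_leS.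
have muh_mu x : mS S (muh x - mu x).
  (* Stage 1 is the first whose distance to the limit is controlled: the bound at stage 0 has order
     0. *)
  apply: (ideal_trans (y := f 1%N x)) => //; first exact: (ideal_pow_sub HI (Hmuh 1%N x)).
  exact: (ideal_pow_sub HI (f_cauchy 0%N x)).
exists muh; split; first split=> //.
  exists muhO => d x; apply: psi_sh_equivariant_nab => //; exact: HScomp.1.
move=> nu' [Hnu' nu'_mu] x; apply: sep => k; move: k x.
apply: (@psi_sh_equivariant_agree _ L R _ (mS S) nu' muh HR HI _ _ _ (psi_sh S)) => //.
- by move=> a; rewrite muhO; case: Hnu'.
- by move=> a ma; have [nuO _] := Hnu'; rewrite nuO; apply: iota_I.
- move=> k x y; rewrite -rmorphB => /chi_pow; by rewrite psiK.
- by move=> x; apply: sheaf_morphism_psi.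
- by move=> x; apply: (ideal_trans (y := mu x)) => //; apply: idealBC.
Qed.
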